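(* Let $X$ be a set and $\Phi\subseteq\mathbf{k}\mathfrak{M}(X)$ a set of multilinear OPIs. Let $A=\mathbf{k}\mathcal{M}(Z)/I_A$ be a unital algebra with generating set $Z$, where $I_A$ is an ideal of $\mathbf{k}\mathcal{M}(Z)$. Then $$\mathcal{F}^{\Phi\text{-}\mathrm{Alg}}_{\mathrm{uAlg}}(A)=\mathbf{k}\mathfrak{M}(Z)/\langle S_\Phi(Z)\cup I_A\rangle_{\mathrm{uOpAlg}},$$ i.e. the quotient on the right-hand side, with the homomorphism from $A$ induced by the inclusion $\mathbf{k}\mathcal{M}(Z)\subseteq\mathbf{k}\mathfrak{M}(Z)$, is the free $\Phi$-algebra over $A$.
   Context: $\mathbf{k}$ is a field; $\mathcal{M}(Z)$ is the free monoid on $Z$, so $\mathbf{k}\mathcal{M}(Z)$ is the free unital algebra on $Z$. A unital operated algebra is a unital $\mathbf{k}$-algebra with a $\mathbf{k}$-linear operator; morphisms are unital algebra homomorphisms commuting with the operators. An operated ideal is an ideal closed under the operator, and $\langle S\rangle_{\mathrm{uOpAlg}}$ is the operated ideal generated by $S$. $\mathfrak{M}(Z)$ is the free operated monoid on $Z$ (monoid with an arbitrary self-map), consisting of bracketed words: $\mathfrak{M}(Z)=\bigcup_n\mathfrak{M}_n$, $\mathfrak{M}_0=\mathcal{M}(Z)$, $\mathfrak{M}_{n+1}=\mathcal{M}(Z\sqcup\lfloor\mathfrak{M}_n\rfloor)$, with operator $u\mapsto\lfloor u\rfloor$; $\mathbf{k}\mathfrak{M}(Z)$ is the free unital operated algebra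 on $Z$. An OPI is an element $\phi=\phi(x_1,\dots,x_n)\in\mathbf{k}\mathfrak{M}(X)$, $n\ge1$, $x_i\in X$; it is multilinear if it is linear in each $x_i$. For elements $r_1,\dots,r_n$ of a unital operated algebra $B$, $\phi(r_1,\dots,r_n)\in B$ is the result of substituting $r_i$ for $x_i$ (with the operator of $B$ replacing $\lfloor\ \rfloor$). A $\Phi$-algebra is a unital operated algebra $B$ with $\phi(r_1,\dots,r_n)=0$ for all $\phi\in\Phi$ and $r_i\in B$. Put $S_\Phi(Z):=\{\phi(u_1,\dots,u_n)\mid u_1,\dots,u_n\in\mathfrak{M}(Z),\ \phi(x_1,\dots,x_n)\in\Phi\}\subseteq\mathbf{k}\mathfrak{M}(Z)$. $\mathcal{F}^{\Phi\text{-}\mathrm{Alg}}_{\mathrm{uAlg}}$ denotes the left adjoint of the forgetful functor from $\Phi$-algebras to unital algebras. *)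

(* Defs.v *)
From HB Require Import structures.
From mathcomp Require Import all_boot all_order all_algebra.
From mathcomp Require Import finmap monalg.
From mathcomp Require Import boolp classical_sets.

Set Implicit Arguments.
Unset Strict Implicit.
Unset Printing Implicit Defensive.

Import GRing.Theory.
Local Open Scope ring_scope.
Local Open Scope quotient_scope.
Local Open Scope classical_set_scope.

(* MathComp's [algType] excludes the zero ring, whereas the quotients formed   *)
(* below may be zero; hence unital algebras are built here on [pzRingType].    *)
(* The scaling is a field of the mixin, and the [lmodType] structure is        *)
(* derived from it, because Hierarchy Builder does not accept a new join of    *)
(* [PzRing] and [Lmodule] above the existing [LSemiAlgebra].                   *)
HB.mixin Record isUAlg (k : fieldType) A of GRing.PzRing A := {
  uscale : k -> A -> A;
  uscaleA : forall a b x, uscale a (uscale b x) = uscale (a * b) x;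
  uscale1 : left_id 1 uscale;
  uscaleDr : right_distributive uscale +%R;
  uscaleDl : forall x, {morph uscale^~ x : a b / a + b};
  uscaleAl : forall a x y, uscale a (x * y) = uscale a x * y;
  uscaleAr : forall a x y, uscale a (x * y) = x * uscale a y
}.

#[short(type="uAlgType")]
HB.structure Definition UAlg (k : fieldType) := {A of GRing.PzRing A & isUAlg k A}.

HB.instance Definition _ (k : fieldType) (A : uAlgType k) :=
  GRing.Zmodule_isLmodule.Build k (UAlg.sort A)
    uscaleA uscale1 uscaleDr uscaleDl.

HB.mixin Record isOperated (k : fieldType) A of UAlg k A := {
  oper : A -> A;
  operD : {morph oper : x y / x + y};
  operZ : forall a : k, {morph oper : x / uscale a x}
}.

#[short(type="uOpAlgType")]
HB.structure Definition UOpAlg (k : fieldType) := {A of UAlg k A & isOperated k A}.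

HB.instance Definition _ (k : fieldType) (A : uOpAlgType k) :=
  GRing.Lmodule.copy (UOpAlg.sort A) (UAlg.sort A).

Lemma oper_linear (k : fieldType) (A : uOpAlgType k) : linear (@oper k A).
Proof. by move=> a x y; rewrite operD; congr (_ + _); exact: operZ. Qed.

HB.instance Definition _ (k : fieldType) (A : uOpAlgType k) :=
  GRing.isLinear.Build k A A *:%R (@oper k A) (@oper_linear k A).

HB.mixin Record isUAlgHom (k : fieldType) (A B : uAlgType k) (f : A -> B)
    of @GRing.RMorphism A B f := {
  uhomZ : forall a : k, {morph f : x / a *: x}
}.

#[short(type="uAlgHom")]
HB.structure Definition UAlgHom (k : fieldType) (A B : uAlgType k) :=
  {f of @GRing.RMorphism A B f & isUAlgHom k A B f}.

HB.instance Definition _ (k : fieldType) (A B : uAlgType k) (f : uAlgHom A B) :=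
  GRing.isScalable.Build k A B *:%R (UAlgHom.sort f) uhomZ.

HB.mixin Record isOperHom (k : fieldType) (A B : uOpAlgType k) (f : A -> B) := {
  uhom_oper : {morph f : x / oper x}
}.

#[short(type="uOpAlgHom")]
HB.structure Definition UOpAlgHom (k : fieldType) (A B : uOpAlgType k) :=
  {f of @UAlgHom k A B f & isOperHom k A B f}.

HB.instance Definition _ (k : fieldType) (A B : uOpAlgType k) (f : uOpAlgHom A B) :=
  GRing.isScalable.Build k A B *:%R (UOpAlgHom.sort f) uhomZ.

Section Ideals.
Variable k : fieldType.

Definition is_ideal (A : uAlgType k) (I : set A) : Prop :=
  [/\ I 0, forall x y, I x -> I y -> I (x + y),
      forall a x, I x -> I (a * x) & forall a x, I x -> I (x * a)].

Record ideal (A : uAlgType k) := Ideal {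
  ideal_set :> set A;
  idealP : is_ideal ideal_set
}.

Record op_ideal (A : uOpAlgType k) := OpIdeal {
  op_ideal_ideal :> ideal A;
  op_idealP : forall x, ideal_set op_ideal_ideal x -> ideal_set op_ideal_ideal (oper x)
}.

Section Generated.
Variables (A : uOpAlgType k) (S : set A).

Definition gen_set : set A :=
  [set x | forall J : op_ideal A, S `<=` ideal_set J -> ideal_set J x].

Lemma gen_is_ideal : is_ideal gen_set.
Proof.
split=> [J SJ|x y Ix Iy J SJ|a x Ix J SJ|a x Ix J SJ];
  have [I0 ID IMl IMr] := idealP J.
- exact: I0.
- by apply: ID; [exact: Ix|exact: Iy].
- by apply: IMl; exact: Ix.
- by apply: IMr; exact: Ix.
Qed.

Lemma gen_oper x : gen_set x -> gen_set (oper x).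
Proof. by move=> Ix J SJ; apply: op_idealP; exact: Ix. Qed.

Definition gen_op_ideal : op_ideal A :=
  @OpIdeal A (Ideal gen_is_ideal) gen_oper.

End Generated.

Section Quotient.
Variables (A : uAlgType k) (I : ideal A).

Definition ideal_pred : A -> bool := fun x => `[< ideal_set I x >].

Lemma ideal_pred_zmod : zmod_closed ideal_pred.
Proof.
have [I0 ID IMl _] := idealP I.
split=> [|x y /asboolP Ix /asboolP Iy]; apply/asboolP => //.
by apply: ID => //; rewrite -mulN1r; apply: IMl.
Qed.

HB.instance Definition _ := GRing.isZmodClosed.Build A ideal_pred ideal_pred_zmod.

Definition quot := Quotient.quot (GRing.ZmodClosed.clone A ideal_pred _).
HB.instance Definition _ := GRing.Zmodule.on quot.
HB.instance Definition _ := EqQuotient.on quot.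

Lemma quot_eqP (x y : A) : reflect (ideal_set I (x - y)) (x == y %[mod quot]).
Proof. by rewrite -Quotient.idealrBE; apply: asboolP. Qed.

Lemma quot_piW (P : quot -> Prop) : (forall x, P (\pi_quot x)) -> forall x, P x.
Proof. by move=> Ppi x; rewrite -[x]reprK. Qed.

Definition quot_one : quot := \pi_quot 1.
Definition quot_mul (x y : quot) : quot := \pi_quot (repr x * repr y).
Definition quot_scale (a : k) (x : quot) : quot := \pi_quot (a *: repr x).

Lemma repr_piP (x : A) : ideal_set I (repr (\pi_quot x) - x).
Proof. by apply/quot_eqP; rewrite reprK. Qed.

Lemma pi_quotD (x y : A) : \pi_quot (x + y) = \pi_quot x + \pi_quot y.
Proof. by rewrite Quotient.pi_add. Qed.

Lemma ideal_scale (a : k) x : ideal_set I x -> ideal_set I (a *: x).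
Proof.
move=> Ix; have [_ _ IMl _] := idealP I.
rewrite -[x]mul1r; have -> : a *: (1 * x : A) = (a *: (1 : A)) * x by exact: uscaleAl.
exact: IMl.
Qed.

Lemma pi_quotM (x y : A) : \pi_quot (x * y) = quot_mul (\pi_quot x) (\pi_quot y).
Proof.
have [_ ID IMl IMr] := idealP I.
symmetry; apply/eqP/quot_eqP; set x' := repr _; set y' := repr _.
have -> : x' * y' - x * y = x' * (y' - y) + (x' - x) * y.
  by rewrite mulrBr mulrBl addrA subrK.
by apply: ID; [apply: IMl|apply: IMr]; exact: repr_piP.
Qed.

Lemma pi_quotZ a (x : A) : \pi_quot (a *: x) = quot_scale a (\pi_quot x).
Proof.
symmetry; apply/eqP/quot_eqP; rewrite -scalerBr.
exact/ideal_scale/repr_piP.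
Qed.

Lemma quot_mulA : associative quot_mul.
Proof.
move=> x y z; elim/quot_piW: x=> x; elim/quot_piW: y=> y; elim/quot_piW: z=> z.
by rewrite -!pi_quotM mulrA.
Qed.
Lemma quot_mul1 : left_id quot_one quot_mul.
Proof. by move=> x; elim/quot_piW: x=> x; rewrite -pi_quotM mul1r. Qed.
Lemma quot_mulr1 : right_id quot_one quot_mul.
Proof. by move=> x; elim/quot_piW: x=> x; rewrite -pi_quotM mulr1. Qed.
Lemma quot_mulDl : left_distributive quot_mul +%R.
Proof.
move=> x y z; elim/quot_piW: x=> x; elim/quot_piW: y=> y; elim/quot_piW: z=> z.
by rewrite -!pi_quotM -!pi_quotD -pi_quotM mulrDl.
Qed.
Lemma quot_mulDr : right_distributive quot_mul +%R.
Proof.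
move=> x y z; elim/quot_piW: x=> x; elim/quot_piW: y=> y; elim/quot_piW: z=> z.
by rewrite -!pi_quotM -!pi_quotD -pi_quotM mulrDr.
Qed.

HB.instance Definition _ := GRing.Zmodule_isPzRing.Build quot
  quot_mulA quot_mul1 quot_mulr1 quot_mulDl quot_mulDr.

Lemma quot_scaleA a b v : quot_scale a (quot_scale b v) = quot_scale (a * b) v.
Proof. by elim/quot_piW: v=> x; rewrite -!pi_quotZ scalerA. Qed.
Lemma quot_scale1 : left_id 1 quot_scale.
Proof. by move=> x; elim/quot_piW: x=> x; rewrite -pi_quotZ scale1r. Qed.
Lemma quot_scaleDr : right_distributive quot_scale +%R.
Proof.
move=> a x y; elim/quot_piW: x=> x; elim/quot_piW: y=> y.
by rewrite -!pi_quotZ -!pi_quotD -pi_quotZ scalerDr.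
Qed.
Lemma quot_scaleDl v : {morph quot_scale^~ v : a b / a + b}.
Proof.
by move=> a b; elim/quot_piW: v=> x; rewrite -!pi_quotZ -pi_quotD scalerDl.
Qed.

Lemma quot_scaleAl a x y : quot_scale a (quot_mul x y) = quot_mul (quot_scale a x) y.
Proof.
move: x y; elim/quot_piW=> x; elim/quot_piW=> y.
rewrite -!(pi_quotM, pi_quotZ); congr (\pi_quot _).
exact: uscaleAl.
Qed.
Lemma quot_scaleAr a x y : quot_scale a (quot_mul x y) = quot_mul x (quot_scale a y).
Proof.
move: x y; elim/quot_piW=> x; elim/quot_piW=> y.
rewrite -!(pi_quotM, pi_quotZ); congr (\pi_quot _).
exact: uscaleAr.
Qed.

HB.instance Definition _ := isUAlg.Build k quot quot_scaleA quot_scale1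
  quot_scaleDr quot_scaleDl quot_scaleAl quot_scaleAr.
HB.instance Definition _ := GRing.Lmodule.copy quot (UAlg.sort quot).

Definition quot_pi (x : A) : quot := \pi_quot x.

Lemma quot_pi_zmod : zmod_morphism quot_pi.
Proof. by move=> x y; rewrite /quot_pi Quotient.pi_add Quotient.pi_opp. Qed.
Lemma quot_pi_monoid : monoid_morphism quot_pi.
Proof. by split=> // x y; exact: pi_quotM. Qed.
Lemma quot_pi_scalable : scalable quot_pi.
Proof. by move=> a x; exact: pi_quotZ. Qed.

HB.instance Definition _ := GRing.isZmodMorphism.Build A quot quot_pi quot_pi_zmod.
HB.instance Definition _ := GRing.isMonoidMorphism.Build A quot quot_pi quot_pi_monoid.
HB.instance Definition _ := isUAlgHom.Build k A quot quot_pi quot_pi_scalable.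

End Quotient.

Section OpQuotient.
Variables (A : uOpAlgType k) (J : op_ideal A).

Definition op_quot := quot J.
HB.instance Definition _ := UAlg.on op_quot.
HB.instance Definition _ := GRing.Lmodule.on op_quot.

Definition op_quot_pi : A -> op_quot := quot_pi J.
HB.instance Definition _ := UAlgHom.on op_quot_pi.

Definition op_quot_oper (x : op_quot) : op_quot := op_quot_pi (oper (repr (x : quot J))).

Lemma op_quot_piP x : op_quot_pi (oper x) = op_quot_oper (op_quot_pi x).
Proof.
symmetry; apply/eqP/(quot_eqP J); rewrite -linearB.
exact/op_idealP/repr_piP.
Qed.

Lemma op_quot_piW (P : op_quot -> Prop) :
  (forall x, P (op_quot_pi x)) -> forall x, P x.
Proof. exact: quot_piW. Qed.

Lemma op_quot_operD : {morph op_quot_oper : x y / x + y}.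
Proof.
move=> x y; move: x y; elim/op_quot_piW=> x; elim/op_quot_piW=> y.
by rewrite -raddfD -!op_quot_piP !raddfD.
Qed.

Lemma op_quot_operZ (a : k) : {morph op_quot_oper : x / uscale a x}.
Proof.
move=> x; move: x; elim/op_quot_piW=> x.
have piZ (y : A) : uscale a (op_quot_pi y) = op_quot_pi (uscale a y).
  by symmetry; exact: uhomZ.
by rewrite piZ -!op_quot_piP piZ operZ.
Qed.

HB.instance Definition _ := isOperated.Build k op_quot op_quot_operD op_quot_operZ.
HB.instance Definition _ := isOperHom.Build k A op_quot op_quot_pi op_quot_piP.

End OpQuotient.
End Ideals.

Section Words.
Variable Z : choiceType.

(* The letters of bracketed words over [Z]: an inductive rendering of          *)
(* $Z \sqcup \lfloor \mathfrak{M}(Z) 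
floor$.                                 *)
Inductive letter := Var of Z | Br of seq letter.

Fixpoint letter_tree (l : letter) : GenTree.tree Z :=
  match l with
  | Var z => GenTree.Leaf z
  | Br w => GenTree.Node 0 (map letter_tree w)
  end.

Fixpoint tree_letter (t : GenTree.tree Z) : letter :=
  match t with
  | GenTree.Leaf z => Var z
  | GenTree.Node _ ts => Br (map tree_letter ts)
  end.

Lemma letter_treeK : cancel letter_tree tree_letter.
Proof.
rewrite /cancel; fix IH 1 => -[z|w] //=; congr Br.
by elim: w => //= l w ->; rewrite IH.
Qed.

HB.instance Definition _ := Choice.copy letter (can_type letter_treeK).

Definition bword := {fmonom letter}.
HB.instance Definition _ := MonomialDef.on bword.

Definition bracket (w : bword) : bword := FMonom [:: Br w].

Definition bword_of_word (w : {fmonom Z}) : bword := FMonom (map Var w).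

Fixpoint letter_vars (l : letter) : seq Z :=
  match l with
  | Var z => [:: z]
  | Br w => flatten (map letter_vars w)
  end.

Definition word_vars (w : bword) : seq Z := flatten (map letter_vars w).

End Words.

Section FreeAlgebras.
Variable k : fieldType.

Section MonoidAlgebra.
Variable K : monomType.
Implicit Types p q : {malg k[K]}.

Lemma malg_scaleAl (a : k) p q : a *: (p * q) = (a *: p) * q.
Proof. exact: fgscaleAl. Qed.

Lemma malg_scaleAr (a : k) p q : a *: (p * q) = p * (a *: q).
Proof.
apply/malgP=> w; rewrite mcoeffZ mcoeffMl.
rewrite (mcoeffMlw w (fsubset_refl _) (msuppZ_le a q)) mulr_sumr.
apply: eq_bigr => u _; rewrite mulr_sumr; apply: eq_bigr => v _.
by rewrite mcoeffZ mulrnAr mulrCA.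
Qed.

HB.instance Definition _ := isUAlg.Build k (malg K k)
  (@scalerA k {malg k[K]}) (@scale1r k {malg k[K]}) (@scalerDr k {malg k[K]})
  (fun v a b => scalerDl v a b) malg_scaleAl malg_scaleAr.
HB.instance Definition _ := UAlg.on {malg k[K]}.
End MonoidAlgebra.

Definition malg_lift (K : choiceType) (V : lmodType k) (h : K -> V)
  (p : {malg k[K]}) : V := \sum_(w <- msupp p) p@_w *: h w.

Section MalgLift.
Variables (K : choiceType) (V : lmodType k) (h : K -> V).

Lemma malg_liftEw (d : {fset K}) (p : {malg k[K]}) : (msupp p `<=` d)%fset ->
  malg_lift h p = \sum_(w <- d) p@_w *: h w.
Proof.
move=> le_d; rewrite [LHS](big_fset_incl _ le_d) //= => w _ /mcoeff_outdom ->.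
by rewrite scale0r.
Qed.

Lemma malg_lift_linear : linear (malg_lift h).
Proof.
move=> a p q; pose d := (msupp (a *: p + q)%R `|` (msupp p `|` msupp q))%fset.
rewrite !(@malg_liftEw d) /d ?fsubsetUl ?fsubsetUr //.
- rewrite scaler_sumr -big_split; apply: eq_bigr => w _ /=.
  by rewrite mcoeffD mcoeffZ scalerDl scalerA.
- by rewrite fsubsetU // fsubsetUr orbT.
- by rewrite fsubsetU // fsubsetUl orbT.
Qed.

End MalgLift.

Section FreeOperated.
Variable Z : choiceType.

Definition malg_bracket (w : bword Z) : {malg k[bword Z]} := << bracket w >>.

Definition malg_oper : {malg k[bword Z]} -> {malg k[bword Z]} :=
  malg_lift malg_bracket.

Lemma malg_operD : {morph malg_oper : p q / p + q}.
Proof.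
move=> p q; have := malg_lift_linear malg_bracket 1 p q.
by rewrite !scale1r.
Qed.

Lemma malg_operZ (a : k) : {morph malg_oper : p / uscale a p}.
Proof.
move=> p; have malg_oper0 : malg_oper 0 = 0.
  by rewrite /malg_oper /malg_lift msupp0 big_seq_fset0.
have := malg_lift_linear malg_bracket a p 0.
by rewrite -/malg_oper malg_oper0 !addr0.
Qed.

HB.instance Definition _ := isOperated.Build k {malg k[bword Z]}
  malg_operD malg_operZ.

(* The inclusion of the free algebra into the free operated algebra. *)
Definition malg_incl (p : {malg k[{fmonom Z}]}) : {malg k[bword Z]} :=
  malg_lift (fun w => << bword_of_word w >>) p.

End FreeOperated.

Section Evaluation.
Variables (X : choiceType) (B : uOpAlgType k) (r : X -> B).

Fixpoint eval_letter (l : letter X) : B :=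
  match l with
  | Var x => r x
  | Br w => oper (foldr (fun l b => eval_letter l * b) 1 w)
  end.

Definition eval_word (w : bword X) : B :=
  foldr (fun l b => eval_letter l * b) 1 w.

Definition eval : {malg k[bword X]} -> B := malg_lift eval_word.

End Evaluation.

Section OPI.
Variable X : choiceType.

Record opi := Opi {
  opi_elt :> {malg k[bword X]};
  opi_arity : nat;
  opi_arity_gt0 : (0 < opi_arity)%N;
  opi_var : 'I_opi_arity -> X;
  opi_var_inj : injective opi_var;
  opi_supp : forall w, w \in msupp opi_elt -> {subset word_vars w <= codom opi_var}
}.

(* [phi(r_1, ..., r_n)]; the value 0 given to the elements of [X] other than   *)
(* [x_1, ..., x_n] is irrelevant by [opi_supp].                                *)
Definition opi_subst (phi : opi) (B : uOpAlgType k)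
    (r : 'I_(opi_arity phi) -> B) : B :=
  eval (fun x => if [pick i | opi_var i == x] is Some i then r i else 0) phi.

Definition multilinear (phi : opi) : Prop :=
  forall (B : uOpAlgType k) (r : 'I_(opi_arity phi) -> B) (i : 'I_(opi_arity phi)),
    linear (fun b : B => opi_subst [eta r with i |-> b]).

Definition is_Phi_algebra (Phi : set opi) (B : uOpAlgType k) : Prop :=
  forall phi, Phi phi -> forall r : 'I_(opi_arity phi) -> B, opi_subst r = 0.

Definition S_Phi (Phi : set opi) (Z : choiceType) : set {malg k[bword Z]} :=
  [set p | exists2 phi, Phi phi &
     exists u : 'I_(opi_arity phi) -> bword Z,
       p = opi_subst (fun i => << u i >> : {malg k[bword Z]})].

(* [i : A -> F] is a universal arrow from [A] to the forgetful functor from    *)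
(* [Phi]-algebras to unital algebras, i.e. [F] with [i] is the value at [A] of *)
(* its left adjoint.                                                           *)
Definition is_free_Phi_algebra (Phi : set opi) (A : uAlgType k)
    (F : uOpAlgType k) (i : uAlgHom A F) : Prop :=
  is_Phi_algebra Phi F /\
  forall (B : uOpAlgType k), is_Phi_algebra Phi B ->
  forall f : uAlgHom A B,
    (exists g : uOpAlgHom F B, forall a, g (i a) = f a) /\
    (forall g g' : uOpAlgHom F B,
        (forall a, g (i a) = f a) -> (forall a, g' (i a) = f a) -> g =1 g').

End OPI.
End FreeAlgebras.

Arguments S_Phi {k X} Phi Z.
Arguments malg_incl {k Z} p%_ring_scope.

(* Main.v *)
Require Import Defs.
From HB Require Import structures.
From mathcomp Require Import all_boot all_order all_algebra.
From mathcomp Require Import finmap monalg.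
From mathcomp Require Import boolp classical_sets.

Set Implicit Arguments.
Unset Strict Implicit.
Unset Printing Implicit Defensive.

Import GRing.Theory.
Local Open Scope ring_scope.
Local Open Scope classical_set_scope.

(** Write pi for the projection of the free operated algebra k M(Z) onto the
    quotient F by the operated ideal J generated by S_Phi(Z) and I_A.

    Universality comes from that of k M(Z): a map r from Z to an operated
    algebra B extends to the operated homomorphism [eval r] ([eval_hom]), and
    this is the only extension ([free_op_hom_ext]).  A homomorphism f from
    A, the quotient by I_A of the free algebra on Z, to a Phi-algebra B gives r,
    the images of the generators.
    On the free algebra, [eval r] agrees with f composed with the projection
    onto A, since both are homomorphisms with the same values on Z
    ([free_hom_ext]); hence [eval r] kills I_A.  It also kills S_Phi(Z), because
    homomorphisms of operated algebras commute with substitution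
    ([hom_opi_subst]) and B satisfies Phi.  Its kernel is an operated ideal, so
    [eval r] kills J and factors through F ([gen_op_ideal_eq0],
    [op_quot_factor]).  Two operated homomorphisms on F that agree on A agree
    on the images of Z, so their composites with pi, hence they themselves,
    coincide.

    That F is a Phi-algebra is where multilinearity enters.  J is only required
    to contain the values of Phi at bracketed words, whereas an identity must
    hold at arbitrary elements of F.  Each of these is the image of a linear
    combination of words, and expanding one argument after another reduces the
    identity to words ([multilinear_eq0], [Phi_algebra_of_S_Phi]). *)

(** * Linear extension from a monoid to its algebra *)

Section MonoidAlgebras.
Variable k : fieldType.

Lemma malg_linear_ind (K : choiceType) (P : {malg k[K]} -> Prop) :
    P 0 -> (forall a p q, P p -> P q -> P (a *: p + q)) ->
    (forall w, P << w >>) ->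
  forall p, P p.
Proof.
move=> P0 PD PU p; rewrite [p]monalgE; elim/big_rec: _ => // w q _ Pq.
suff -> : << p@_w *g w >> = p@_w *: << w >> :> {malg k[K]} by exact: PD.
by apply/malgP => v; rewrite mcoeffZ !mcoeffU mulrnAr mulr1.
Qed.

HB.instance Definition _ (K : choiceType) (V : lmodType k) (h : K -> V) :=
  GRing.isLinear.Build k {malg k[K]} V *:%R (malg_lift h) (malg_lift_linear h).

Lemma malg_liftU (K : choiceType) (V : lmodType k) (h : K -> V) w :
  malg_lift h << w >> = h w.
Proof. by rewrite /malg_lift msuppU oner_eq0 big_seq_fset1 mcoeffUU scale1r. Qed.

Lemma malgUM (K : monomType) (u v : K) :
  << mmul u v >> = << u >> * << v >> :> {malg k[K]}.
Proof. by rewrite malgM_def fgmulUU mulr1. Qed.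

Lemma malg_lift_monoid (K : monomType) (B : uAlgType k) (h : K -> B) :
    h mone = 1 -> {morph h : u v / mmul u v >-> u * v} ->
  monoid_morphism (malg_lift h : {malg k[K]} -> B).
Proof.
move=> h1 hM; split=> [|p q]; first by have := malg_liftU h mone; rewrite h1.
elim/malg_linear_ind: p => [|a p p' IHp IHp'|u].
- by rewrite mul0r linear0 mul0r.
- rewrite mulrDl -malg_scaleAl !linearP /= IHp IHp' mulrDl.
  congr (_ + _); exact: uscaleAl.
elim/malg_linear_ind: q => [|a q q' IHq IHq'|v].
- by rewrite mulr0 linear0 mulr0.
- rewrite mulrDr -malg_scaleAr !linearP /= IHq IHq' mulrDr.
  congr (_ + _); exact: uscaleAr.
by rewrite -malgUM !malg_liftU hM.
Qed.
End MonoidAlgebras.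

(** * Homomorphisms, quotients and generated ideals *)

Section Homomorphisms.
Variable k : fieldType.

Lemma uAlgHom_of (A B : uAlgType k) (f : A -> B) :
  linear f -> monoid_morphism f -> exists g : uAlgHom A B, g =1 f.
Proof.
move=> f_lin f_mon.
have f_zmod : zmod_morphism f.
  by move=> x y; rewrite addrC -scaleN1r f_lin scaleN1r addrC.
have fZ : forall a : k, {morph f : x / a *: x}.
  move=> a x; have f0 : f 0 = 0 by rewrite -(subrr 0) f_zmod subrr.
  by have := f_lin a x 0; rewrite f0 !addr0.
pose zf := GRing.isZmodMorphism.Build A B f f_zmod.
pose mf := GRing.isMonoidMorphism.Build A B f f_mon.
pose fr : {rmorphism A -> B} := HB.pack f zf mf.
pose uf := isUAlgHom.Build k A B fr fZ.
pose g : uAlgHom A B := HB.pack f zf mf uf.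
by exists g.
Qed.

Lemma uOpAlgHom_of (A B : uOpAlgType k) (f : uAlgHom A B) :
  {morph f : x / oper x} -> exists g : uOpAlgHom A B, g =1 f.
Proof.
move=> f_oper; pose oH := isOperHom.Build k A B f f_oper.
pose g : uOpAlgHom A B := HB.pack (UAlgHom.sort f) oH.
by exists g.
Qed.

Lemma uAlgHom_comp (A B C : uAlgType k) (g : uAlgHom B C) (f : uAlgHom A B) :
  exists h : uAlgHom A C, h =1 g \o f.
Proof.
apply: uAlgHom_of => [a x y|]; first by rewrite /= !linearP.
by split=> [|x y]; rewrite /= ?rmorph1 // !rmorphM.
Qed.

Lemma uOpAlgHom_comp (A B C : uOpAlgType k) (g : uOpAlgHom B C)
    (f : uOpAlgHom A B) : exists h : uOpAlgHom A C, h =1 g \o f.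
Proof.
have [h hE] := uAlgHom_comp g f.
suff /uOpAlgHom_of [h' h'E] : {morph h : x / oper x}.
  by exists h' => x; rewrite h'E hE.
by move=> x; rewrite !hE /= !uhom_oper.
Qed.

Lemma oper0 (A : uOpAlgType k) : oper 0 = 0 :> A.
Proof. exact: raddf0. Qed.

Lemma quot_pi_ind (A : uAlgType k) (I : ideal A) (P : quot I -> Prop) :
  (forall x, P (quot_pi I x)) -> forall x, P x.
Proof. exact: quot_piW. Qed.

Lemma quot_pi_eq0 (A : uAlgType k) (I : ideal A) x :
  ideal_set I x -> quot_pi I x = 0.
Proof.
rewrite -[x in ideal_set I x]subr0 -(raddf0 (quot_pi I)) => Ix.
exact/eqP/quot_eqP.
Qed.

Lemma quot_factor (A B : uAlgType k) (I : ideal A) (f : uAlgHom A B) :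
    (forall x, ideal_set I x -> f x = 0) ->
  exists g : uAlgHom (quot I) B, forall x, g (quot_pi I x) = f x.
Proof.
move=> fI; have [g gE] : exists g : quot I -> B, forall x, g (quot_pi I x) = f x.
  exists (fun x => f (repr x)) => x.
  by apply/subr0_eq; rewrite -raddfB; apply/fI/repr_piP.
have g_lin : linear g.
  move=> a x y; elim/quot_pi_ind: x => x; elim/quot_pi_ind: y => y.
  by rewrite -uhomZ -raddfD !gE linearP.
have g_mon : monoid_morphism g.
  split=> [|x y]; first by rewrite -(rmorph1 (quot_pi I)) gE rmorph1.
  elim/quot_pi_ind: x => x; elim/quot_pi_ind: y => y.
  by rewrite -rmorphM !gE rmorphM.
have [h hE] := uAlgHom_of g_lin g_mon.
by exists h => x; rewrite hE.
Qed.

Lemma op_quot_factor (A B : uOpAlgType k) (J : op_ideal A) (f : uOpAlgHom A B) :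
    (forall x, ideal_set J x -> f x = 0) ->
  exists g : uOpAlgHom (op_quot J) B, forall x, g (op_quot_pi J x) = f x.
Proof.
move=> /(quot_factor (I := J) (f := f)) [g gE].
have g_oper : {morph (g : op_quot J -> B) : x / oper x}.
  elim/op_quot_piW => x; rewrite -uhom_oper !gE; exact: uhom_oper.
have [h hE] := uOpAlgHom_of (f := (g : uAlgHom (op_quot J) B)) g_oper.
by exists h => x; rewrite hE gE.
Qed.

(** The kernel of a homomorphism of operated algebras is an operated ideal. *)
Lemma gen_op_ideal_eq0 (A B : uOpAlgType k) (S : set A) (f : uOpAlgHom A B) :
    (forall x, S x -> f x = 0) ->
  forall x, ideal_set (gen_op_ideal S) x -> f x = 0.
Proof.
move=> fS x; pose K : set A := fun x => f x = 0.
have K_ideal : is_ideal K.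
  split=> [|y z Ky Kz|a y Ky|a y Ky]; rewrite /K.
  - exact: raddf0.
  - by rewrite raddfD /= Ky Kz addr0.
  - by rewrite rmorphM /= Ky mulr0.
  - by rewrite rmorphM /= Ky mul0r.
have K_oper y : K y -> K (oper y) by rewrite /K uhom_oper => ->; exact: raddf0.
by move=> /(_ (@OpIdeal _ _ (Ideal K_ideal) K_oper)); apply.
Qed.

Lemma gen_op_ideal_incl (A : uOpAlgType k) (S : set A) x :
  S x -> ideal_set (gen_op_ideal S) x.
Proof. by move=> Sx J; apply. Qed.

End Homomorphisms.

(** * The free operated algebra *)

Section BracketedWords.
Variable Z : choiceType.

(** The generated principle for [letter] has no hypothesis on the letters inside
    a bracket; this one also descends into the brackets. *)
Lemma bword_ind (P : bword Z -> Prop) :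
    P (FMonom [::]) ->
    (forall z w, P w -> P (FMonom (Var z :: w))) ->
    (forall u w, P u -> P w -> P (FMonom (Br u :: w))) ->
  forall w, P w.
Proof.
move=> P1 PVar PBr [w].
have Pl : forall l w, P w -> P (FMonom (l :: w)).
  fix IH 1 => -[z|u] v Pv; first exact: PVar.
  apply: (PBr (FMonom u)) Pv.
  by elim: u => // l u IHu; apply: (IH l (FMonom u)).
by elim: w => // l w; apply: (Pl l (FMonom w)).
Qed.
End BracketedWords.

Section FreeOperatedAlgebra.
Variable k : fieldType.

Lemma malg_operU (Z : choiceType) (w : bword Z) :
  oper << w >> = << bracket w >> :> {malg k[bword Z]}.
Proof. exact: malg_liftU. Qed.

Lemma bword_varE (Z : choiceType) z (w : bword Z) :
  << (FMonom (Var z :: w) : bword Z) >> =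
  << (FMonom [:: Var z] : bword Z) >> * << w >> :> {malg k[bword Z]}.
Proof. by rewrite -malgUM; congr << _ >>; rewrite /mmul /= fmmulE. Qed.

Lemma bword_brE (Z : choiceType) (u w : bword Z) :
  << (FMonom (Br u :: w) : bword Z) >> = oper << u >> * << w >> :> {malg k[bword Z]}.
Proof. by rewrite malg_operU -malgUM; congr << _ >>; rewrite /mmul /= fmmulE. Qed.

Lemma bword_nilE (Z : choiceType) :
  << (FMonom [::] : bword Z) >> = 1 :> {malg k[bword Z]}.
Proof. by rewrite -fmoneE. Qed.

(** Letters and brackets generate: peeling the first letter off a word writes it
    as a product of a variable or a bracket and a shorter word. *)
Lemma free_op_hom_ext (Z : choiceType) (B : uOpAlgType k)
    (f g : uOpAlgHom {malg k[bword Z]} B) :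
    (forall z, f << (FMonom [:: Var z] : bword Z) >> =
               g << (FMonom [:: Var z] : bword Z) >>) ->
  f =1 g.
Proof.
move=> fgZ; elim/malg_linear_ind => [|a p q fgp fgq|].
- by rewrite !raddf0.
- by rewrite !linearP /= fgp fgq.
elim/bword_ind => [|z w IH|u w IHu IHw].
- by rewrite bword_nilE !rmorph1.
- by rewrite bword_varE !rmorphM /= fgZ IH.
- by rewrite bword_brE !rmorphM /= !uhom_oper IHu IHw.
Qed.

Lemma eval_hom (X : choiceType) (B : uOpAlgType k) (r : X -> B) :
  exists f : uOpAlgHom {malg k[bword X]} B, f =1 eval r.
Proof.
have ev_mon : monoid_morphism (eval r).
  apply: malg_lift_monoid => [|u v]; first by rewrite /mone /= fmoneE.
  rewrite /mmul /= fmmulE /eval_word /= foldr_cat.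
  elim: (u : seq _) => [|l s IH] /=; first by rewrite mul1r.
  by rewrite IH mulrA.
have [f fE] := uAlgHom_of (malg_lift_linear (eval_word r)) ev_mon.
suff /uOpAlgHom_of [g gE] : {morph f : p / oper p}.
  by exists g => p; rewrite gE fE.
elim/malg_linear_ind => [|a p q IHp IHq|w].
- by rewrite oper0 (raddf0 f) oper0.
- have fP x y : f (a *: x + y) = a *: f x + f y by exact: linearP.
  rewrite (oper_linear a p q) !fP (oper_linear a).
  by congr (a *: _ + _); [exact: IHp|exact: IHq].
by rewrite malg_operU !fE !malg_liftU /eval_word /= mulr1.
Qed.

Lemma hom_eval (X : choiceType) (B C : uOpAlgType k) (g : uOpAlgHom B C)
  (r : X -> B) p : g (eval r p) = eval (g \o r) p.
Proof.
rewrite /eval; elim/malg_linear_ind: p => [|a p q IHp IHq|w].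
- by rewrite !raddf0.
- by rewrite !linearP /= IHp IHq.
rewrite !malg_liftU; elim/bword_ind: w => [|x w IH|u w IHu IHw].
- exact: rmorph1.
- by rewrite /eval_word /= rmorphM; congr (_ * _).
- rewrite /eval_word /= rmorphM /= uhom_oper.
  by congr (oper _ * _).
Qed.

Lemma hom_opi_subst (X : choiceType) (phi : opi k X) (B C : uOpAlgType k)
    (g : uOpAlgHom B C) (r : 'I_(opi_arity phi) -> B) :
  g (opi_subst r) = opi_subst (g \o r).
Proof.
rewrite /opi_subst hom_eval; congr (eval _ _); apply: funext => x /=.
by case: pickP => // _; exact: raddf0.
Qed.

Lemma malg_incl_hom (Z : choiceType) :
  exists f : uAlgHom {malg k[{fmonom Z}]} {malg k[bword Z]}, f =1 malg_incl.
Proof.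
apply: uAlgHom_of; first exact: malg_lift_linear.
apply: malg_lift_monoid => [|u v].
  by rewrite /mone /= fmoneE /bword_of_word /= bword_nilE.
by rewrite -malgUM /mmul /= !fmmulE /bword_of_word /= map_cat.
Qed.

Lemma free_hom_ext (Z : choiceType) (B : uAlgType k)
    (f g : uAlgHom {malg k[{fmonom Z}]} B) :
    (forall z, f << FMonom [:: z] >> = g << FMonom [:: z] >>) -> f =1 g.
Proof.
move=> fgZ; elim/malg_linear_ind => [|a p q fgp fgq|[w]].
- by rewrite !raddf0.
- by rewrite !linearP /= fgp fgq.
elim: w => [|z w IH]; first by rewrite -fmoneE !rmorph1.
suff -> : << FMonom (z :: w) >> = << FMonom [:: z] >> * << FMonom w >>
    :> {malg k[{fmonom Z}]} by rewrite !rmorphM /= fgZ IH.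
by rewrite -malgUM /mmul /= fmmulE.
Qed.

End FreeOperatedAlgebra.

(** * Multilinear identities *)

Section Multilinear.
Variable k : fieldType.

(** Expanding one argument while the others stay fixed replaces it by basis
    elements; after [n] such steps only values at basis elements remain. *)
Lemma multilinear_eq0 (n : nat) (K : choiceType) (V W : lmodType k)
    (s : {linear {malg k[K]} -> V}) (M : ('I_n -> V) -> W) :
    (forall r i, linear (fun v => M [eta r with i |-> v])) ->
    (forall u : 'I_n -> K, M (fun i => s << u i >>) = 0) ->
  forall p : 'I_n -> {malg k[K]}, M (s \o p) = 0.
Proof.
move=> M_lin MU p.
(* Induction on [m]: the arguments from index [m] on are basis elements, the
   earlier ones arbitrary. *)
suff Mm m (q : 'I_n -> {malg k[K]}) :
    (forall i : 'I_n, m <= i -> exists w, q i = << w >>)%N -> M (s \o q) = 0.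
  by apply: (Mm n) => i; rewrite leqNgt ltn_ord.
elim: m q => [|m IHm] q q_mono.
  have /choice[u uE] i := q_mono i isT.
  by rewrite -[RHS](MU u); congr M; apply: funext => i /=; rewrite uE.
have [lt_mn|le_nm] := ltnP m n; last first.
  by apply: IHm => i le_mi; have := ltn_ord i; rewrite ltnNge (leq_trans le_nm le_mi).
pose j := Ordinal lt_mn; pose L v := M [eta s \o q with j |-> v].
have L_lin : linear L by apply: M_lin.
have -> : M (s \o q) = L (s (q j)).
  by congr M; apply: funext => i /=; case: eqP => // ->.
elim/malg_linear_ind: (q j) => [|a p1 p2 IH1 IH2|w].
- (* linearity at [-1 *: 0 + 0] gives [L 0 = - L 0 + L 0] *)
  by have := L_lin (-1) 0 0; rewrite scaler0 addr0 scaleN1r addNr raddf0.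
- by rewrite linearP L_lin IH1 IH2 scaler0 addr0.
rewrite -(IHm [eta q with j |-> << w >>]).
  by congr M; apply: funext => i /=; case: eqP.
move=> i le_mi /=; case: eqP => [_|/eqP ne_ij]; first by exists w.
by apply: q_mono; rewrite ltn_neqAle le_mi andbT eq_sym.
Qed.

End Multilinear.

(** * Free algebras with multilinear identities *)

Section FreePhiAlgebra.
Variables (k : fieldType) (X : choiceType) (Phi : set (opi k X)) (Z : choiceType).

(** Multilinearity spreads the identities from words to their linear
    combinations; surjectivity makes those exhaust [F]. *)
Lemma Phi_algebra_of_S_Phi (F : uOpAlgType k)
    (pi : uOpAlgHom {malg k[bword Z]} F) :
    (forall phi, Phi phi -> multilinear phi) ->
    (forall x, exists p, x = pi p) ->
    (forall p, S_Phi Phi Z p -> pi p = 0) ->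
  is_Phi_algebra Phi F.
Proof.
move=> Phi_lin pi_surj pi_S phi Phi_phi r.
have /choice[p pE] i := pi_surj (r i).
have -> : r = pi \o p by apply: funext.
apply: (multilinear_eq0 (s := pi) (M := @opi_subst _ _ phi _)) => [|u].
  exact: (Phi_lin phi Phi_phi F).
rewrite -[LHS]/(opi_subst (pi \o fun i => << u i >>)) -hom_opi_subst.
by apply: pi_S; exists phi => //; exists u.
Qed.

Lemma Phi_algebra_S_Phi (B : uOpAlgType k) (f : uOpAlgHom {malg k[bword Z]} B) p :
  is_Phi_algebra Phi B -> S_Phi Phi Z p -> f p = 0.
Proof. by move=> BPhi [phi Phi_phi [u ->]]; rewrite hom_opi_subst; exact: BPhi. Qed.

End FreePhiAlgebra.

Theorem proposition4p8 (k : fieldType) (X : choiceType) (Phi : set (opi k X))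
    (Phi_multilinear : forall phi, Phi phi -> multilinear phi)
    (Z : choiceType) (I_A : ideal {malg k[{fmonom Z}]}) :
  let A := quot I_A in
  let F := op_quot (gen_op_ideal (S_Phi Phi Z `|` malg_incl @` ideal_set I_A)) in
  exists iota : uAlgHom A F,
    (forall p : {malg k[{fmonom Z}]},
        iota (quot_pi I_A p) = op_quot_pi _ (malg_incl p)) /\
    is_free_Phi_algebra Phi iota.
Proof.
set S := (S_Phi Phi Z `|` _) => A F.
have [incl inclE] := malg_incl_hom k Z.
have inclU z : incl << FMonom [:: z] >> = << (FMonom [:: Var z] : bword Z) >>.
  by rewrite inclE; exact: malg_liftU.
have [pi_incl pi_inclE] := uAlgHom_comp (op_quot_pi (gen_op_ideal S)) incl.
have [p I_p|iota iotaE] := @quot_factor _ _ _ I_A pi_incl.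
  rewrite pi_inclE /= inclE; apply: quot_pi_eq0; apply/gen_op_ideal_incl.
  by right; exists p.
exists iota; split=> [p|]; first by rewrite iotaE pi_inclE /= inclE.
split=> [|B BPhi f].
  apply: (Phi_algebra_of_S_Phi (pi := op_quot_pi (gen_op_ideal S))) => // [x|p Sp].
    by elim/op_quot_piW: x => p; exists p.
  by apply: quot_pi_eq0; apply/gen_op_ideal_incl; left.
split=> [|g g' gE g'E].
  (* Existence: evaluate words at the images under [f] of the generators. *)
  have [f_pi f_piE] := uAlgHom_comp f (quot_pi I_A).
  have [ev evE] := eval_hom (fun z => f_pi << FMonom [:: z] >>).
  have [ev_incl ev_inclE] := uAlgHom_comp ev incl.
  have ev_f : ev_incl =1 f_pi.
    apply: free_hom_ext => z; rewrite ev_inclE /= inclU evE.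
    by rewrite /eval malg_liftU /eval_word /= mulr1.
  have [x Sx|g gE] := @op_quot_factor _ _ _ (gen_op_ideal S) ev.
    apply: gen_op_ideal_eq0 Sx => p [/Phi_algebra_S_Phi-> //|[q I_q <-]].
    rewrite -inclE -[LHS]/((ev \o incl) q) -ev_inclE ev_f f_piE /=.
    by rewrite (quot_pi_eq0 I_q); exact: raddf0.
  exists g => a; elim/quot_pi_ind: a => p.
  by rewrite iotaE pi_inclE /= gE -[LHS]/((ev \o incl) p) -ev_inclE ev_f f_piE.
(* Uniqueness: compare on the free operated algebra, where variables decide. *)
have [h hE] := uOpAlgHom_comp g (op_quot_pi (gen_op_ideal S)).
have [h' h'E] := uOpAlgHom_comp g' (op_quot_pi (gen_op_ideal S)).
suff hh' : h =1 h' by elim/op_quot_piW => x; rewrite -[LHS]hE -[RHS]h'E.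
apply: free_op_hom_ext => z; rewrite hE h'E /= -inclU.
by rewrite -[op_quot_pi _ _]pi_inclE -iotaE gE g'E.
Qed.
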